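(* In ABC, strong bisimilarity $\sim$ is a congruence for all operators: for all ABC expressions $P,Q,R$, all $\alpha\in Act$, all $c\in H$ and all relabellings $f$, if $P\sim Q$ then $\alpha.P\sim\alpha.Q$, $P+R\sim Q+R$, $R+P\sim R+Q$, $P|R\sim Q|R$, $R|P\sim R|Q$, $P\backslash c\sim Q\backslash c$ and $P[f]\sim Q[f]$.
   Context: ABC (Algebra of Broadcast Communication) is parametrised by sets $\mathcal A$ of agent identifiers, $\mathcal B$ of broadcast names and $\mathcal C$ of handshake communication names. Let $\bar{\mathcal C}=\{\bar c\mid c\in\mathcal C\}$, $H=\mathcal C\cup\bar{\mathcal C}$ (disjoint union; the handshake actions), with $\bar{\bar c}=c$; $\mathcal B!=\{b!\mid b\in\mathcal B\}$ (broadcast actions), $\mathcal B?=\{b?\mid b\in\mathcal B\}$ (receive actions), and $Act=\mathcal B!\cup\mathcal B?\cup H\cup\{\tau\}$ (disjoint union). A relabelling is a function $f$ mapping $\mathcal B$ into $\mathcal B$ and $\mathcal C$ into $\mathcal C$, extended to $Act$ by $f(\bar c)=\overline{f(c)}$, $f(b\sharp)=f(b)\sharp$ for $\sharp\in\{!,?\}$, $f(\tau)=\tau$. ABC expressions are generated by $0$, $\alpha.E$ ($\alpha\in Act$), $E+F$, $E|F$, $E\backslash c$ ($c\in H$), $E[f]$ ($f$ a relabelling), and $A\in\mathcal A$; each $A\in\mathcal A$ has a defining equation $A\stackrel{def}{=}P$ with $P$ guarded (each agent identifier in $P$ occurs within the scope of a prefix). The transition relation $\to\subseteq \mathcal T_{ABC}\times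 Act\times\mathcal T_{ABC}$ (where $\mathcal T_{ABC}$ is the set of expressions) is the least relation closed under the following rules, where $\alpha,\ell\in Act$, $\eta\in H\cup\{\tau\}$, $c\in H$, $b\in\mathcal B$: (Act) $\alpha.E\xrightarrow{\alpha}E$; (Sum-l) $E\xrightarrow{\alpha}E'$ implies $E+F\xrightarrow{\alpha}E'$; (Sum-r) $F\xrightarrow{\alpha}F'$ implies $E+F\xrightarrow{\alpha}F'$; (Par-l) $E\xrightarrow{\eta}E'$ implies $E|F\xrightarrow{\eta}E'|F$; (Par-r) $F\xrightarrow{\eta}F'$ implies $E|F\xrightarrow{\eta}E|F'$; (Comm) $E\xrightarrow{c}E'$ and $F\xrightarrow{\bar c}F'$ imply $E|F\xrightarrow{\tau}E'|F'$; (Bro-l) $E\xrightarrow{b\sharp_1}E'$ with $\sharp_1\in\{!,?\}$ and $F$ having no outgoing $b?$-transition imply $E|F\xrightarrow{b\sharp_1}E'|F$; (Bro-r) symmetrically $F\xrightarrow{b\sharp_2}F'$ and $E$ having no outgoing $b?$-transition imply $E|F\xrightarrow{b\sharp_2}E|F'$; (Bro-c) $E\xrightarrow{b\sharp_1}E'$ and $F\xrightarrow{b\sharp_2}F'$ imply $E|F\xrightarrow{b\sharp}E'|F'$, where $\sharp=\sharp_1\circ\sharp_2$ with $!\circ?=?\circ!=!$, $?\circ?=?$ and $!\circ!$ undefined (no rule instance); (Rel) $E\xrightarrow{\ell}E'$ implies $E[f]\xrightarrow{f(\ell)}E'[f]$; (Res) $E\xrightarrow{\ell}E'$ with $\ell\notin\{c,\bar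 c\}$ implies $E\backslash c\xrightarrow{\ell}E'\backslash c$; (Rec) $P\xrightarrow{\ell}E'$ and $A\stackrel{def}{=}P$ imply $A\xrightarrow{\ell}E'$. Strong bisimilarity is the standard notion on this labelled transition system. *)

(* Defs.v *)
From Stdlib Require Import Classical.

Set Implicit Arguments.

Inductive handshake (C : Type) : Type :=
| Name (c : C)
| CoName (c : C).

Definition bar {C : Type} (h : handshake C) : handshake C :=
  match h with Name c => CoName c | CoName c => Name c end.

Inductive mode : Type := Bang | Query.

Definition mode_comp (s1 s2 : mode) : option mode :=
  match s1, s2 with
  | Bang, Bang => None
  | Bang, Query => Some Bang
  | Query, Bang => Some Bang
  | Query, Query => Some Query
  end.

(* [Bro b Bang] is b! and [Bro b Query] is b?. *)
Inductive action (B C : Type) : Type :=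
| Bro (b : B) (s : mode)
| Hand (h : handshake C)
| Tau.

Arguments Bro {B C} b s.
Arguments Hand {B C} h.
Arguments Tau {B C}.

Definition handshake_or_tau {B C : Type} (l : action B C) : Prop :=
  match l with Bro _ _ => False | Hand _ => True | Tau => True end.

Record relabelling (B C : Type) : Type := Relabelling {
  rel_bro : B -> B;
  rel_name : C -> C
}.

Definition relabel {B C : Type} (f : relabelling B C) (l : action B C)
    : action B C :=
  match l with
  | Bro b s => Bro (rel_bro f b) s
  | Hand (Name c) => Hand (Name (rel_name f c))
  | Hand (CoName c) => Hand (CoName (rel_name f c))
  | Tau => Tau
  end.

Inductive expr (A B C : Type) : Type :=
| Nil
| Prefix (l : action B C) (E : expr A B C)
| Sum (E F : expr A B C)
| Par (E F : expr A B C)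
| Restrict (E : expr A B C) (c : handshake C)
| Relabel (E : expr A B C) (f : relabelling B C)
| Ident (a : A).

Arguments Nil {A B C}.
Arguments Ident {A B C} a.

Fixpoint guarded {A B C : Type} (E : expr A B C) : Prop :=
  match E with
  | Nil => True
  | Prefix _ _ => True
  | Sum E F => guarded E /\ guarded F
  | Par E F => guarded E /\ guarded F
  | Restrict E _ => guarded E
  | Relabel E _ => guarded E
  | Ident _ => False
  end.

Record equations (A B C : Type) : Type := Equations {
  body : A -> expr A B C;
  body_guarded : forall a : A, guarded (body a)
}.

(* The least relation closed under the rules when the negative premise
   "F has no outgoing b?-transition" is read as [N b F]. *)
Inductive derivable {A B C : Type} (D : equations A B C)
    (N : B -> expr A B C -> Prop)
    : expr A B C -> action B C -> expr A B C -> Prop :=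
| Act l E :
    derivable D N (Prefix l E) l E
| Sum_l E F l E' :
    derivable D N E l E' ->
    derivable D N (Sum E F) l E'
| Sum_r E F l F' :
    derivable D N F l F' ->
    derivable D N (Sum E F) l F'
| Par_l E F l E' :
    handshake_or_tau l ->
    derivable D N E l E' ->
    derivable D N (Par E F) l (Par E' F)
| Par_r E F l F' :
    handshake_or_tau l ->
    derivable D N F l F' ->
    derivable D N (Par E F) l (Par E F')
| Comm E F c E' F' :
    derivable D N E (Hand c) E' ->
    derivable D N F (Hand (bar c)) F' ->
    derivable D N (Par E F) Tau (Par E' F')
| Bro_l E F b s1 E' :
    derivable D N E (Bro b s1) E' ->
    N b F ->
    derivable D N (Par E F) (Bro b s1) (Par E' F)
| Bro_r E F b s2 F' :
    N b E ->
    derivable D N F (Bro b s2) F' ->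
    derivable D N (Par E F) (Bro b s2) (Par E F')
| Bro_c E F b s1 s2 s E' F' :
    mode_comp s1 s2 = Some s ->
    derivable D N E (Bro b s1) E' ->
    derivable D N F (Bro b s2) F' ->
    derivable D N (Par E F) (Bro b s) (Par E' F')
| Rel E f l E' :
    derivable D N E l E' ->
    derivable D N (Relabel E f) (relabel f l) (Relabel E' f)
| Res E c l E' :
    l <> Hand c ->
    l <> Hand (bar c) ->
    derivable D N E l E' ->
    derivable D N (Restrict E c) l (Restrict E' c)
| Rec a l E' :
    derivable D N (body D a) l E' ->
    derivable D N (Ident a) l E'.

Definition refuses {A B C : Type}
    (T : expr A B C -> action B C -> expr A B C -> Prop)
    (b : B) (F : expr A B C) : Prop :=
  ~ exists F', T F (Bro b Query) F'.

(* The rules have negative premises, so the relations closed under them are not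
   closed under intersection.  As usual, the transition relation is the one that
   is least among those closed under the rules when the negative premises are
   evaluated in that relation itself (stable model).  [step_transition_relation]
   and [transition_relation_unique] below show that there is exactly one. *)
Definition transition_relation {A B C : Type} (D : equations A B C)
    (T : expr A B C -> action B C -> expr A B C -> Prop) : Prop :=
  forall E l E', T E l E' <-> derivable D (refuses T) E l E'.

Definition step {A B C : Type} (D : equations A B C)
    (E : expr A B C) (l : action B C) (E' : expr A B C) : Prop :=
  exists T, transition_relation D T /\ T E l E'.

Definition bisimulation {A B C : Type} (D : equations A B C)
    (S : expr A B C -> expr A B C -> Prop) : Prop :=
  forall P Q, S P Q ->
    (forall l P', step D P l P' -> exists Q', step D Q l Q' /\ S P' Q') /\
    (forall l Q', step D Q l Q' -> exists P', step D P l P' /\ S P' Q').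

Definition bisimilar {A B C : Type} (D : equations A B C)
    (P Q : expr A B C) : Prop :=
  exists S, bisimulation D S /\ S P Q.

(* Auxiliary to the existence proof only. *)
Inductive receives {A B C : Type} (D : equations A B C)
    : B -> expr A B C -> Prop :=
| rcv_act b E : receives D b (Prefix (Bro b Query) E)
| rcv_sum_l b E F : receives D b E -> receives D b (Sum E F)
| rcv_sum_r b E F : receives D b F -> receives D b (Sum E F)
| rcv_par_l b E F : receives D b E -> receives D b (Par E F)
| rcv_par_r b E F : receives D b F -> receives D b (Par E F)
| rcv_res b E c : receives D b E -> receives D b (Restrict E c)
| rcv_rel b E f : receives D b E -> receives D (rel_bro f b) (Relabel E f)
| rcv_rec b a : receives D b (body D a) -> receives D b (Ident a).

Lemma derivable_mono {A B C : Type} (D : equations A B C)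
    (N N' : B -> expr A B C -> Prop) :
  (forall b F, N b F -> N' b F) ->
  forall E l E', derivable D N E l E' -> derivable D N' E l E'.
Proof.
  intros H E l E' d.
  induction d; try (econstructor; eauto; fail).
Qed.

Lemma expr_guarded_ind {A B C : Type} (D : equations A B C)
    (P : expr A B C -> Prop) :
  P Nil ->
  (forall l E, P (Prefix l E)) ->
  (forall E F, P E -> P F -> P (Sum E F)) ->
  (forall E F, P E -> P F -> P (Par E F)) ->
  (forall E c, P E -> P (Restrict E c)) ->
  (forall E f, P E -> P (Relabel E f)) ->
  (forall a, P (body D a) -> P (Ident a)) ->
  forall E, P E.
Proof.
  intros H0 Hp Hs Hpar Hres Hrel Hid.
  assert (K : forall E, guarded E \/ (forall a, P (Ident a)) -> P E).
  { induction E as [|l E IH|E IHE F IHF|E IHE F IHF|E IH c|E IH f|a];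
      simpl; intros g; auto.
    - apply Hs; [apply IHE|apply IHF]; tauto.
    - apply Hpar; [apply IHE|apply IHF]; tauto.
    - destruct g; [contradiction|auto]. }
  intro E; apply K; right; intro a.
  apply Hid, K; left; apply body_guarded.
Qed.

Lemma receives_sound {A B C : Type} (D : equations A B C)
    (N : B -> expr A B C -> Prop) E l E' :
  derivable D N E l E' -> forall b, l = Bro b Query -> receives D b E.
Proof.
  intro d.
  induction d as [l E|E F l E' d IH|E F l F' d IH|E F l E' h d IH|E F l F' h d IH
    |E F c E' F' d1 IH1 d2 IH2|E F b s E' d IH n|E F b s F' n d IH
    |E F b s1 s2 s E' F' m d1 IH1 d2 IH2|E f l E' d IH|E c l E' n1 n2 d IH
    |a l E' d IH]; intros b0 e.
  - subst; apply rcv_act.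
  - apply rcv_sum_l; auto.
  - apply rcv_sum_r; auto.
  - subst; destruct h.
  - subst; destruct h.
  - discriminate.
  - apply rcv_par_l; auto.
  - apply rcv_par_r; auto.
  - injection e as -> ->; destruct s1, s2; try discriminate.
    apply rcv_par_l; auto.
  - destruct l as [b s|[c|c]|]; try discriminate.
    simpl in e; injection e as <- ->; apply rcv_rel; auto.
  - apply rcv_res; auto.
  - apply rcv_rec; auto.
Qed.

Lemma receives_complete {A B C : Type} (D : equations A B C) (E : expr A B C) :
  forall b, receives D b E ->
  exists E', derivable D (fun b F => ~ receives D b F) E (Bro b Query) E'.
Proof.
  induction E as [|l E|E F IHE IHF|E F IHE IHF|E c IH|E f IH|a IH]
    using (expr_guarded_ind D); intros b H; inversion H; subst.
  - eexists; apply Act.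
  - destruct (IHE b) as [E' d]; auto; eexists; apply Sum_l; eauto.
  - destruct (IHF b) as [F' d]; auto; eexists; apply Sum_r; eauto.
  - destruct (IHE b) as [E' d]; auto.
    destruct (classic (receives D b F)) as [r|r].
    + destruct (IHF b r) as [F' d'].
      eexists; eapply Bro_c; eauto; reflexivity.
    + eexists; apply Bro_l; eauto.
  - destruct (IHF b) as [F' d]; auto.
    destruct (classic (receives D b E)) as [r|r].
    + destruct (IHE b r) as [E' d'].
      eexists; eapply Bro_c; eauto; reflexivity.
    + eexists; apply Bro_r; eauto.
  - destruct (IH b) as [E' d]; auto.
    eexists; apply Res; eauto; discriminate.
  - match goal with r : receives D ?x E |- _ => destruct (IH x r) as [E' d] end.
    eexists; exact (Rel f d).
  - destruct (IH b) as [E' d]; auto; eexists; apply Rec; eauto.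
Qed.

Lemma transition_relation_exists {A B C : Type} (D : equations A B C) :
  exists T, transition_relation D T.
Proof.
  exists (derivable D (fun b F => ~ receives D b F)).
  intros E l E'; split; apply derivable_mono; intros b F n.
  - intros [F' d]; apply n; exact (receives_sound d eq_refl).
  - intro r; apply n; exact (receives_complete r).
Qed.

Lemma transition_relation_unique {A B C : Type} (D : equations A B C)
    (T T' : expr A B C -> action B C -> expr A B C -> Prop) :
  transition_relation D T -> transition_relation D T' ->
  forall E l E', T E l E' <-> T' E l E'.
Proof.
  intros HT HT' E.
  induction E as [|l0 E|E F IHE IHF|E F IHE IHF|E c IH|E f IH|a IH]
    using (expr_guarded_ind D); intros l X;
  rewrite (HT _ l), (HT' _ l);
  split; intro d; inversion d; subst;
  repeat match goal with
       | r : derivable D (refuses T) _ _ _ |- _ => apply HT in r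
       | r : derivable D (refuses T') _ _ _ |- _ => apply HT' in r
       end;
  repeat match goal with
       | IH : forall l X, T ?E l X <-> T' ?E l X, r : T ?E _ _ |- _ =>
           apply IH in r; apply HT' in r
       | IH : forall l X, T ?E l X <-> T' ?E l X, r : T' ?E _ _ |- _ =>
           apply IH in r; apply HT in r
       end;
  try solve [econstructor; eauto];
  match goal with
       | n : refuses _ ?b ?G, IH : forall l X, T ?G l X <-> T' ?G l X |- _ =>
         first [apply Bro_l | apply Bro_r]; trivial;
         intros [G' g]; apply n; exists G'; apply IH; exact g
       end.
Qed.

Lemma step_eq {A B C : Type} (D : equations A B C) T :
  transition_relation D T -> forall E l E', step D E l E' <-> T E l E'.
Proof.
  intros HT E l E'; split.
  - intros [T' [HT' H]]; exact (proj1 (transition_relation_unique HT' HT E l E') H).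
  - intro H; exists T; auto.
Qed.

Lemma step_transition_relation {A B C : Type} (D : equations A B C) :
  transition_relation D (step D).
Proof.
  destruct (transition_relation_exists D) as [T HT].
  intros E l E'; rewrite (step_eq HT), (HT E l E').
  split; apply derivable_mono; intros b F n [F' s]; apply n; exists F';
    apply (step_eq HT); exact s.
Qed.

Lemma step_minimal {A B C : Type} (D : equations A B C)
    (T : expr A B C -> action B C -> expr A B C -> Prop) :
  (forall E l E', derivable D (refuses T) E l E' -> T E l E') ->
  (forall E l E', T E l E' -> step D E l E') ->
  forall E l E', step D E l E' -> T E l E'.
Proof.
  intros closed incl E l E' s; apply closed.
  apply step_transition_relation in s; revert s.
  apply derivable_mono; intros b F n [F' t]; apply n; exists F'; auto.
Qed.

(* Main.v *)
(** The closure of bisimilarity under all operators is itself a bisimulation: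
    by induction on its generation, each rule instance for one expression is
    matched by the same rule for the related one.  The negative premises of the
    broadcast rules are preserved because related expressions simulate each
    other in both directions, so they refuse the same receive actions. *)

Require Import Defs.

Set Implicit Arguments.

(** Binary operators change both arguments at once, because [Comm] and [Bro_c] move both components
    and the targets must stay related. An argument left as it is enters through reflexivity of
    bisimilarity. *)
Inductive bisimilar_closure {A B C : Type} (D : equations A B C)
    : expr A B C -> expr A B C -> Prop :=
| closure_bisimilar P Q :
    bisimilar D P Q ->
    bisimilar_closure D P Q
| closure_prefix l P Q :
    bisimilar_closure D P Q ->
    bisimilar_closure D (Prefix l P) (Prefix l Q)
| closure_sum P Q R S :
    bisimilar_closure D P Q ->
    bisimilar_closure D R S ->
    bisimilar_closure D (Sum P R) (Sum Q S)
| closure_par P Q R S :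
    bisimilar_closure D P Q ->
    bisimilar_closure D R S ->
    bisimilar_closure D (Par P R) (Par Q S)
| closure_restrict P Q c :
    bisimilar_closure D P Q ->
    bisimilar_closure D (Restrict P c) (Restrict Q c)
| closure_relabel P Q f :
    bisimilar_closure D P Q ->
    bisimilar_closure D (Relabel P f) (Relabel Q f).

Lemma bisimilar_refl {A B C : Type} (D : equations A B C) (P : expr A B C) :
  bisimilar D P P.
Proof.
  exists eq; split; trivial.
  intros E F <-; split; eauto.
Qed.

Lemma bisimilar_bisimulation {A B C : Type} (D : equations A B C) :
  bisimulation D (bisimilar D).
Proof.
  intros P Q [S [HS s]].
  destruct (HS P Q s) as [fwd bwd]; split; intros l X t.
  - destruct (fwd l X t) as [Y [u s']]; exists Y; split; [|exists S]; auto.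
  - destruct (bwd l X t) as [Y [u s']]; exists Y; split; [|exists S]; auto.
Qed.

Lemma bisimilar_sym {A B C : Type} (D : equations A B C) (P Q : expr A B C) :
  bisimilar D P Q -> bisimilar D Q P.
Proof.
  intros [S [HS s]]; exists (fun E F => S F E); split; trivial.
  intros E F s'; destruct (HS F E s'); split; auto.
Qed.

Lemma bisimilar_closure_sym {A B C : Type} (D : equations A B C)
    (P Q : expr A B C) :
  bisimilar_closure D P Q -> bisimilar_closure D Q P.
Proof.
  induction 1; try (constructor; assumption).
  apply closure_bisimilar, bisimilar_sym; assumption.
Qed.

(** Half of the transfer condition at a single pair: each operator is treated in one direction only,
    and symmetry of the closure gives the other. *)
Definition simulated {A B C : Type} (D : equations A B C)
    (S : expr A B C -> expr A B C -> Prop) (P Q : expr A B C) : Prop :=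
  forall l P', step D P l P' -> exists Q', step D Q l Q' /\ S P' Q'.

(** Refusals travel against the simulation: a [b?]-transition of [Q] would be answered by one of
    [P]. *)
Lemma refuses_simulated {A B C : Type} (D : equations A B C)
    (S : expr A B C -> expr A B C -> Prop) (P Q : expr A B C) (b : B) :
  simulated D S Q P -> refuses (step D) b P -> refuses (step D) b Q.
Proof.
  intros sim n [Q' t]; apply n.
  destruct (sim _ _ t) as [P' [u _]]; exists P'; exact u.
Qed.

Section OperatorsSimulated.

Context {A B C : Type} (D : equations A B C).

Local Notation closure := (bisimilar_closure D).
Local Notation sim := (simulated D (bisimilar_closure D)).

Ltac invert_step t :=
  apply step_transition_relation in t; inversion t; subst; clear t;
  repeat match goal with
    | r : derivable D (refuses (step D)) _ _ _ |- _ =>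
        apply step_transition_relation in r
    end.

Ltac answer :=
  repeat match goal with
    | H : sim ?P _, t : step D ?P _ _ |- _ =>
        let u := fresh "u" in
        destruct (H _ _ t) as [? [u ?]]; clear t;
        (* As a derivation, [u] is ready for the rules and no longer triggers the loop through a
           simulation in the reverse direction. *)
        apply step_transition_relation in u
    end;
  eexists; split; [apply step_transition_relation|].

Lemma prefix_simulated l P Q :
  closure P Q -> sim (Prefix l P) (Prefix l Q).
Proof.
  intros r k X t; invert_step t; answer; [apply Act|exact r].
Qed.

Lemma sum_simulated P Q R S :
  sim P Q -> sim R S -> sim (Sum P R) (Sum Q S).
Proof.
  intros H K k X t; invert_step t; answer; eauto using Sum_l, Sum_r.
Qed.

(** A component that stays put must still be related in the target, hence the closure hypotheses.
    The reverse simulations carry the refusals in [Bro_l] and [Bro_r]. *)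
Lemma par_simulated P Q R S :
  closure P Q -> closure R S -> sim P Q -> sim Q P -> sim R S -> sim S R ->
  sim (Par P R) (Par Q S).
Proof.
  intros r r' H H' K K' k X t; invert_step t; answer;
    try (apply closure_par; eassumption).
  - apply Par_l; eassumption.
  - apply Par_r; eassumption.
  - eapply Comm; eassumption.
  - apply Bro_l; eauto using refuses_simulated.
  - apply Bro_r; eauto using refuses_simulated.
  - eapply Bro_c; eassumption.
Qed.

Lemma restrict_simulated P Q c :
  sim P Q -> sim (Restrict P c) (Restrict Q c).
Proof.
  intros H k X t; invert_step t; answer;
    [apply Res|apply closure_restrict]; eassumption.
Qed.

Lemma relabel_simulated P Q f :
  sim P Q -> sim (Relabel P f) (Relabel Q f).
Proof.
  intros H k X t; invert_step t; answer;
    [apply Rel|apply closure_relabel]; eassumption.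
Qed.

(** Both directions go through one induction, since the parallel case of either one calls on both
    for the components. *)
Lemma bisimilar_closure_simulated P Q :
  closure P Q -> sim P Q /\ sim Q P.
Proof.
  induction 1 as [P Q r|l P Q r IH|P Q R S r1 [] r2 []|P Q R S r1 [] r2 []
    |P Q c r []|P Q f r []].
  - split; intros l X t.
    + destruct (proj1 (bisimilar_bisimulation r) l X t) as [Y [u s]].
      eauto using closure_bisimilar.
    + destruct (proj2 (bisimilar_bisimulation r) l X t) as [Y [u s]].
      eauto using closure_bisimilar, bisimilar_sym.
  - split; apply prefix_simulated; auto using bisimilar_closure_sym.
  - split; apply sum_simulated; assumption.
  - split; apply par_simulated; auto using bisimilar_closure_sym.
  - split; apply restrict_simulated; assumption.
  - split; apply relabel_simulated; assumption.
Qed.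

Lemma bisimilar_closure_bisimulation : bisimulation D closure.
Proof.
  intros P Q r; destruct (bisimilar_closure_simulated r) as [fwd bwd].
  split; [exact fwd|]; intros l X t.
  destruct (bwd l X t) as [Y [u s]]; eauto using bisimilar_closure_sym.
Qed.

Lemma bisimilar_closure_bisimilar P Q : closure P Q -> bisimilar D P Q.
Proof.
  intro r; exists closure; split; [apply bisimilar_closure_bisimulation|exact r].
Qed.

End OperatorsSimulated.

Theorem theorem1 (A B C : Type) (D : equations A B C) (P Q R : expr A B C)
    (l : action B C) (c : handshake C) (f : relabelling B C) :
  bisimilar D P Q ->
  bisimilar D (Prefix l P) (Prefix l Q) /\
  bisimilar D (Sum P R) (Sum Q R) /\
  bisimilar D (Sum R P) (Sum R Q) /\
  bisimilar D (Par P R) (Par Q R) /\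
  bisimilar D (Par R P) (Par R Q) /\
  bisimilar D (Restrict P c) (Restrict Q c) /\
  bisimilar D (Relabel P f) (Relabel Q f).
Proof.
  intro r; apply closure_bisimilar in r.
  (* Relates the fixed argument [R] to itself, so that the two-sided constructors cover the
     one-sided claims. *)
  pose proof (closure_bisimilar (bisimilar_refl D R)) as refl.
  repeat split; apply bisimilar_closure_bisimilar; constructor; assumption.
Qed.
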